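(* Let $\mathcal D\subseteq(0,1)$ be nonempty and $f:\mathcal D\to(0,1)$. The following are equivalent: (I) $f$ has a block simulation; (II) $f$ can be simulated by a finite automaton; (III) $f$ is the restriction to $\mathcal D$ of a rational function $F\in\mathbb Q(x)$ that is defined and satisfies $0<F(x)<1$ for all $x\in(0,1)$.
   Context: For $w\in\{0,1\}^*$ let $n_i(w)$ be the number of $i$'s in $w$; $\mathbf P_p[w]=p^{n_1(w)}(1-p)^{n_0(w)}$ and $\mathbf P_p[L]=\sum_{w\in L}\mathbf P_p[w]$. A simulation of $f:\mathcal D\to[0,1]$ is a pair of disjoint languages $L_0,L_1\subseteq\{0,1\}^*$ with $L_0\cup L_1$ prefix-free such that $\mathbf P_p[L_0\cup L_1]=1$ and $\mathbf P_p[L_1]=f(p)$ for all $p\in\mathcal D$. A finite automaton consists of finite state set $S$, start state $s_0$, transition function $\delta:S\times\{0,1\}\to S$ (extended to strings), and disjoint absorbing final-state sets $S_0,S_1$; $L_i$ is the set of strings $w$ with $\delta(s_0,w)\in S_i$ and $\delta(s_0,w')\notin S_0\cup S_1$ for every proper prefix $w'$ of $w$; the automaton simulates $f$ if $(L_0,L_1)$ is a simulation of $f$. A block simulation of $f$ is a simulation of the following form: for some $k\ge1$ and disjoint sets $A_0,A_1\subseteq\{0,1\}^k$, with $A'=\{0,1\}^k\setminus(A_0\cup A_1)$, one has $L_i=(A')^*A_i$, i.e. $L_i$ is the set of concatenations $u_1u_2\cdots u_mv$ with $m\ge0$, $u_j\in A'$, $v\in A_i$ (read $k$-bit blocks, output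 $i$ on a block in $A_i$, discard blocks in $A'$). *)

(* Defs.v *)
From HB Require Import structures.
From mathcomp Require Import all_boot all_order all_algebra.
From mathcomp Require Import all_classical all_reals.
From mathcomp Require Import ereal esum.
Set Implicit Arguments. Unset Strict Implicit. Unset Printing Implicit Defensive.
Import Order.TTheory GRing.Theory Num.Theory.
Local Open Scope classical_set_scope.
Local Open Scope ring_scope.

Section Sim.
Variable R : realType.

Definition word_prob (p : R) (w : seq bool) : R :=
  p ^+ count id w * (1 - p) ^+ count negb w.

Definition lang_prob (p : R) (L : set (seq bool)) : \bar R :=
  \esum_(w in L) (word_prob p w)%:E.

Definition prefix_free (L : set (seq bool)) : Prop :=
  forall u v, L u -> L v -> prefix u v -> u = v.

Definition is_simulation (D : set R) (f : R -> R) (L0 L1 : set (seq bool)) : Prop :=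
  L0 `&` L1 = set0 /\ prefix_free (L0 `|` L1) /\
  forall p, D p -> lang_prob p (L0 `|` L1) = 1%E /\ lang_prob p L1 = (f p)%:E.

Definition block_lang (A' A : set (seq bool)) : set (seq bool) :=
  [set w | exists (us : seq (seq bool)) (v : seq bool),
      (forall u, u \in us -> A' u) /\ A v /\ w = flatten us ++ v].

Definition has_block_simulation (D : set R) (f : R -> R) : Prop :=
  exists k : nat, (0 < k)%N /\
  exists A0 A1 : set (seq bool),
    A0 `<=` [set u | size u = k] /\ A1 `<=` [set u | size u = k] /\
    A0 `&` A1 = set0 /\
    let A' := [set u : seq bool | size u = k /\ ~ A0 u /\ ~ A1 u] in
    is_simulation D f (block_lang A' A0) (block_lang A' A1).

Definition aut_lang (S : finType) (s0 : S) (delta : S -> bool -> S)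
    (Si Fin : {set S}) : set (seq bool) :=
  [set w | foldl delta s0 w \in Si /\
     forall n, (n < size w)%N -> foldl delta s0 (take n w) \notin Fin].

Definition automaton_simulable (D : set R) (f : R -> R) : Prop :=
  exists (S : finType) (s0 : S) (delta : S -> bool -> S) (S0 S1 : {set S}),
    (S0 :&: S1 = finset.set0) /\
    (forall s b, s \in S0 -> delta s b \in S0) /\
    (forall s b, s \in S1 -> delta s b \in S1) /\
    is_simulation D f (aut_lang s0 delta S0 (S0 :|: S1))
                      (aut_lang s0 delta S1 (S0 :|: S1)).

Definition qeval (P : {poly rat}) (x : R) : R := (map_poly ratr P).[x].

Definition rational_restriction (D : set R) (f : R -> R) : Prop :=
  exists P Q : {poly rat},
    (forall x : R, 0 < x < 1 ->
       qeval Q x != 0 /\ 0 < qeval P x / qeval Q x < 1) /\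
    (forall p, D p -> f p = qeval P p / qeval Q p).

End Sim.

(* Main.v *)
(* (I) => (II): remember the part of the current block that has been read.

   (II) => (III): for every p in (0,1) the probabilities of output 1 from the
   various states solve a linear system whose coefficients are polynomials in p.
   By the maximum principle the system is nonsingular on the whole of (0,1), so
   Cramer's rule gives one rational function for all p.  It is positive because
   some word outputs 1, and less than 1 because some word outputs 0 and, by
   Kraft's inequality, the two outputs together have probability at most 1.

   (III) => (I): write F = N/(N+M) with integer polynomials N, M positive on
   (0,1).  Up to factors x and 1-x such a polynomial is positive on [0,1], and
   then its Bernstein coefficients in high degree are positive (Polya).  So N and
   M are combinations of the x^i(1-x)^(n-i) with natural coefficients, and after
   multiplication by a power of x(1-x) these coefficients can be realised as
   numbers of words of given weight in disjoint sets of blocks. *)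
Require Import Defs.
From HB Require Import structures.
From mathcomp Require Import all_boot all_order all_algebra.
From mathcomp Require Import all_classical all_reals.
From mathcomp Require Import ereal esum.
From mathcomp Require Import topology normedtype derive.
From mathcomp Require Import ring lra zify.
Set Implicit Arguments. Unset Strict Implicit. Unset Printing Implicit Defensive.
Import Order.TTheory GRing.Theory Num.Theory numFieldNormedType.Exports.
Local Open Scope classical_set_scope.
Local Open Scope ring_scope.

(** * Probabilities of languages *)

(** The bound [le_esumZl] comes from finite partial sums; applied to [c^-1] and the scaled family it
    gives the reverse bound for positive [c]. *)
Lemma esumZl (R : realType) (T : choiceType) (S : set T) (c : R) (a : T -> \bar R) :
  0 <= c -> (forall i, S i -> 0 <= a i)%E ->
  (\esum_(i in S) (c%:E * a i) = c%:E * \esum_(i in S) a i)%E.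
Proof.
have le_esumZl (b : T -> \bar R) (e : R) :
    0 <= e -> (forall i, S i -> 0 <= b i)%E ->
    (\esum_(i in S) (e%:E * b i) <= e%:E * \esum_(i in S) b i)%E.
  move=> e0 b0; apply: ge_ereal_sup => _ [X [finX XS]] <-.
  rewrite fsbig_finite// big_seq -ge0_sume_distrr; last first.
    by move=> i; rewrite in_fset_set// inE => /XS /b0.
  rewrite -big_seq lee_wpmul2l ?lee_fin// -fsbig_finite//.
  by apply: esum_ge; exists X.
move=> c0 a0; apply/eqP; rewrite eq_le le_esumZl//=.
have [c_gt0|c_le0] := ltP 0 c; last first.
  have -> : c = 0 by apply/eqP; rewrite eq_le c_le0.
  by rewrite mul0e esum_ge0// => i _; rewrite mul0e.
have cV : (c%:E * c^-1%:E = 1)%E by rewrite -EFinM divff ?gt_eqF.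
rewrite -[leRHS]mul1e -cV -muleA lee_wpmul2l ?lee_fin//.
have b0 i : S i -> (0 <= c%:E * a i)%E by move=> Si; rewrite mule_ge0 ?lee_fin ?a0.
rewrite -(_ : \esum_(i in S) (c^-1%:E * (c%:E * a i)) = esum S a)%E.
  by apply: le_esumZl; rewrite ?invr_ge0.
by apply: eq_esum => i _; rewrite muleA (muleC c^-1%:E) cV mul1e.
Qed.

Section LangProb.
Variables (R : realType) (p : R).
Hypothesis p01 : 0 <= p <= 1.
Implicit Types (u v w : seq bool) (L : set (seq bool)).

Lemma word_prob_cat u v : word_prob p (u ++ v) = word_prob p u * word_prob p v.
Proof. by rewrite /word_prob !count_cat !exprD mulrACA. Qed.

Lemma word_prob_ge0 w : 0 <= word_prob p w.
Proof. by case/andP: p01 => p0 p1; rewrite mulr_ge0// exprn_ge0// subr_ge0. Qed.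

Lemma lang_prob_ge0 L : (0 <= lang_prob p L)%E.
Proof. by apply: esum_ge0 => w _; rewrite lee_fin word_prob_ge0. Qed.

Lemma lang_prob0 : lang_prob p set0 = 0%E.
Proof. exact: esum_set0. Qed.

Lemma lang_prob_nil : lang_prob p [set [::]] = 1%E.
Proof. by rewrite /lang_prob esum_set1 ?lee_fin ?word_prob_ge0// /word_prob mulr1. Qed.

Lemma lang_probU L1 L2 : L1 `&` L2 = set0 ->
  lang_prob p (L1 `|` L2) = (lang_prob p L1 + lang_prob p L2)%E.
Proof.
move=> dis; rewrite /lang_prob (@esumID _ _ L1); last first.
  by move=> w _; rewrite lee_fin word_prob_ge0.
rewrite setUK; congr (_ + esum _ _)%E.
by rewrite setIUl setIC setICl set0U; apply/setDidPl; rewrite setIC.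
Qed.

Lemma lang_prob_le1_of_bounded L :
  (forall n, lang_prob p (L `&` [set w | size w <= n]%N) <= 1)%E ->
  (lang_prob p L <= 1)%E.
Proof.
move=> le1; apply: ge_ereal_sup => _ [X [finX XL]] <-.
have [n Xn] : exists n, forall w, X w -> (size w <= n)%N.
  have /finite_seqP[s Xs] := finX; exists (\max_(w <- s) size w)%N => w.
  by rewrite Xs => ws; apply: leq_bigmax_seq.
apply: le_trans (le1 n); apply: esum_ge; exists X => //; split=> // w Xw.
by split; [exact: XL|exact: Xn].
Qed.

(** No [c i] is a prefix of another, so the leading [c i] and the residual word are unique. Used for
    the first letter and for the first block. *)
Lemma lang_prob_split (I : finType) (c : I -> seq bool) L :
  (forall i j u v, c i ++ u = c j ++ v -> i = j) ->
  (forall w, L w -> exists i u, w = c i ++ u) ->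
  lang_prob p L =
  (\sum_i (word_prob p (c i))%:E * lang_prob p [set w | L (c i ++ w)])%E.
Proof.
move=> c_inj Lc.
pose D i := [set w | L (c i ++ w)].
have bij : set_bij ([set: I] `*`` D) L (fun k => c k.1 ++ k.2).
  split=> [[i w] [_ Lw]//|[i u] [j v] _ _ /= e|w Lw].
    have ij := c_inj _ _ _ _ e; move: e; rewrite ij.
    by move=> /eqP; rewrite eqseq_cat// => /andP[_ /eqP->].
  by have [i [u wE]] := Lc _ Lw; exists (i, u) => //=; split=> //; rewrite /D /= -wE.
rewrite [LHS](reindex_esum _ _ _ _ bij).
transitivity (\esum_(i in [set: I]) \esum_(w in D i) (word_prob p (c i ++ w))%:E)%E.
  by rewrite esum_esum// => i w _ _; rewrite lee_fin word_prob_ge0.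
transitivity (\esum_(i in [set: I])
    ((word_prob p (c i))%:E * lang_prob p (D i)))%E.
  apply: eq_esum => i _; rewrite -esumZl ?word_prob_ge0//; last first.
    by move=> w _; rewrite lee_fin word_prob_ge0.
  by apply: eq_esum => w _; rewrite word_prob_cat EFinM.
have finI : finite_set [set: I] by exact: finite_finset.
rewrite esum_fset//; last first.
  by move=> i _; rewrite mule_ge0 ?lang_prob_ge0// lee_fin word_prob_ge0.
rewrite (_ : [set: I] = [set` index_enum I]); last first.
  by apply/seteqP; split=> i //= _; rewrite mem_index_enum.
by rewrite -fsbig_seq ?index_enum_uniq.
Qed.

Lemma lang_prob_step L : ~ L [::] ->
  lang_prob p L = (p%:E * lang_prob p [set w | L (true :: w)] +
    (1 - p)%:E * lang_prob p [set w | L (false :: w)])%E.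
Proof.
move=> L0; rewrite (@lang_prob_split bool (fun b => [:: b])); last 2 first.
- by move=> i j u v [].
- by case=> [/L0//|b w _]; exists b, w.
by rewrite big_bool/= /word_prob/= !expr0 !expr1 mulr1 mul1r.
Qed.

(** Induction on a length bound: a prefix-free language with the empty word contains nothing else;
    otherwise the first letter gives a convex combination of two probabilities at most 1. *)
Lemma kraft_le1 L : prefix_free L -> (lang_prob p L <= 1)%E.
Proof.
move=> pfL; apply: lang_prob_le1_of_bounded => n.
have nil_only L' : prefix_free L' -> L' [::] -> L' = [set [::]].
  move=> pfL' L'0; apply/seteqP; split=> [w L'w|w ->//].
  by symmetry; apply: pfL' => //; exact: prefix0s.
elim: n L pfL => [|n IHn] L pfL; (have [L0|L0] := pselect (L [::]);
  [by rewrite (nil_only _ pfL L0) setIidl ?lang_prob_nil// => w ->|]).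
  rewrite (_ : L `&` _ = set0) ?lang_prob0//; apply/seteqP; split=> w //= [Lw].
  by rewrite leqn0 size_eq0 => /eqP w0; apply: L0; rewrite -w0.
rewrite lang_prob_step; last by case.
have le1 b : (lang_prob p [set w | (L `&` [set w | size w <= n.+1]%N) (b :: w)] <= 1)%E.
  rewrite (_ : [set w | _] = [set w | L (b :: w)] `&` [set w | size w <= n]%N)//.
  apply: IHn => u v Lu Lv uv.
  by have := pfL _ _ Lu Lv; rewrite /= eqxx => /(_ uv) [].
case/andP: p01 => p0 p1.
apply: (@le_trans _ _ (p%:E * 1 + (1 - p)%:E * 1)%E).
  by apply: leeD; rewrite lee_wpmul2l ?lee_fin// subr_ge0.
by rewrite !mule1 -EFinD addrC subrK.
Qed.

Lemma lang_prob_prefix_free_fin L : prefix_free L -> lang_prob p L \is a fin_num.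
Proof.
move=> /kraft_le1 le1; rewrite ge0_fin_numE ?lang_prob_ge0//.
by rewrite (le_lt_trans le1) ?ltry.
Qed.

End LangProb.

Lemma lang_prob_gt0 (R : realType) (p : R) (L : set (seq bool)) (w : seq bool) :
  0 < p < 1 -> L w -> (0 < lang_prob p L)%E.
Proof.
move=> /andP[p0 p1] Lw; apply: (@lt_le_trans _ _ (word_prob p w)%:E).
  by rewrite lte_fin mulr_gt0// exprn_gt0// subr_gt0.
apply: esum_ge; exists [set w]; last by rewrite fsbig_set1.
by split; [exact: finite_set1|move=> _ ->].
Qed.

(** * Automata *)

Section AutLang.
Variables (S : finType) (delta : S -> bool -> S) (Fin : {set S}).
Implicit Types (s : S) (X Y : {set S}) (w : seq bool).

Lemma aut_lang_nil s X : aut_lang s delta X Fin [::] <-> s \in X.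
Proof. by split=> [[]|sX]//; split. Qed.

Lemma aut_lang_cons s X b w : s \notin Fin ->
  aut_lang s delta X Fin (b :: w) <-> aut_lang (delta s b) delta X Fin w.
Proof.
move=> sF; split=> -[wX wF]; split=> // n.
  by move=> nw; have := wF n.+1; rewrite /= ltnS; apply.
by case: n => [|n]//= nw; exact: wF.
Qed.

Lemma aut_lang_final s X w : s \in Fin ->
  aut_lang s delta X Fin w <-> w = [::] /\ s \in X.
Proof.
move=> sF; case: w => [|b w]; first by split=> [[]|[_ sX]]//; split.
by split=> [[_ /(_ 0%N isT)]|[]//]; rewrite /= sF.
Qed.

Lemma aut_langU s X Y : aut_lang s delta (X :|: Y) Fin =
  aut_lang s delta X Fin `|` aut_lang s delta Y Fin.
Proof.
apply/seteqP; split=> w.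
  by case; rewrite inE => /orP[wX|wY] wF; [left|right].
by case=> -[wX wF]; split=> //; rewrite inE wX ?orbT.
Qed.

Lemma aut_lang_disjoint s X Y : X :&: Y = finset.set0 ->
  aut_lang s delta X Fin `&` aut_lang s delta Y Fin = set0.
Proof.
move=> XY; apply/seteqP; split=> w //= [[wX _] [wY _]].
by have := finset.in_set0 (foldl delta s w); rewrite -XY inE wX wY.
Qed.

Lemma prefix_free_aut_lang s X : X \subset Fin ->
  prefix_free (aut_lang s delta X Fin).
Proof.
move=> /fintype.subsetP XF u v [uX _] [_ vF] /prefixP[w vE].
case: w vE => [|b w]; first by rewrite cats0.
move=> vE; have := vF (size u); rewrite vE size_cat -[ltnLHS]addn0 ltn_add2l.
by rewrite take_size_cat// XF// => /(_ isT).
Qed.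

(* In non-final states that are not live the output languages are empty. *)
Definition live s : bool :=
  (s \notin Fin) && `[< exists w, foldl delta s w \in Fin >].

(** Acts on row vectors: column [j] is the first-letter equation at state [j], or a unit column if
    that state is not live. With the weaker test [s \notin Fin], a closed set of states avoiding
    [Fin] would make the matrix singular. The ring is general because the matrix is used over
    [{poly rat}] and over the reals. *)
Definition transition_mx (K : comNzRingType) (x : K) : 'M[K]_#|S| :=
  \matrix_(i, j) ((i == j)%:R - if live (enum_val j) then
     (enum_val i == delta (enum_val j) true)%:R * x
     + (enum_val i == delta (enum_val j) false)%:R * (1 - x) else 0).

Lemma map_transition_mx (K K' : comNzRingType) (g : {rmorphism K -> K'}) x :
  map_mx g (transition_mx x) = transition_mx (g x).
Proof.
apply/matrixP => i j; rewrite !mxE rmorphB rmorph_nat; congr (_ - _).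
by case: ifP; rewrite ?rmorph0// rmorphD !rmorphM rmorphB rmorph1 !rmorph_nat.
Qed.

Lemma mul_transition_mx (K : comNzRingType) (x : K) (v : 'rV_#|S|) j :
  (v *m transition_mx x) 0 j = v 0 j -
    if live (enum_val j) then
      x * v 0 (enum_rank (delta (enum_val j) true))
      + (1 - x) * v 0 (enum_rank (delta (enum_val j) false))
    else 0.
Proof.
have sum_delta (k : 'I_#|S|) : \sum_i v 0 i * (i == k)%:R = v 0 k.
  by rewrite (bigD1 k)//= eqxx mulr1 big1 ?addr0// => i /negPf->; rewrite mulr0.
rewrite mxE; under eq_bigr do rewrite mxE mulrBr.
rewrite sumrB sum_delta; congr (_ - _).
case: ifP => _; last by rewrite big1// => i _; rewrite mulr0.
under eq_bigr do rewrite mulrDr !mulrA !(can2_eq (@enum_valK _) (@enum_rankK _)).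
by rewrite big_split/= -!mulr_suml !sum_delta mulrC [_ * (1 - x)]mulrC.
Qed.

(** A kernel vector is a weighted mean of its successor values at live states and zero elsewhere.
    Both weights are positive, so a maximal absolute value passes to both successors and along every
    word; but some word leads from a live state into [Fin], where the vector vanishes. *)
Lemma transition_mx_det_neq0 (K : realFieldType) (x : K) : 0 < x < 1 ->
  \det (transition_mx x) != 0.
Proof.
move=> /andP[x0 x1]; apply/negP => /det0P[v v_neq0 vA].
have vE j : v 0 j = if live (enum_val j) then
      x * v 0 (enum_rank (delta (enum_val j) true))
      + (1 - x) * v 0 (enum_rank (delta (enum_val j) false)) else 0.
  by apply/eqP; rewrite -subr_eq0 -mul_transition_mx vA mxE.
have [i0 vi0] : exists i, v 0 i != 0 by exact/rV0Pn.
have [i _ maxi'] := @Order.TotalTheory.arg_maxP _ _ _ i0 xpredT (fun i => `|v 0 i|) isT.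
have maxi j : `|v 0 j| <= `|v 0 i| by exact: maxi'.
have M0 : 0 < `|v 0 i| by rewrite (lt_le_trans _ (maxi i0))// normr_gt0.
(* maximum principle: a maximum of |v| spreads along the transitions *)
have spread w : forall j, `|v 0 j| = `|v 0 i| ->
    foldl delta (enum_val j) w \notin Fin.
  elim: w => [|b w IHw] j jM /=.
    apply/negP => jF; move: M0; rewrite -jM vE /live jF/= normr0 ltxx//.
  have jlive : live (enum_val j).
    by apply: contraT => /negPf jl; move: M0; rewrite -jM vE jl normr0 ltxx.
  rewrite -[delta _ _]enum_rankK; apply: IHw; apply/eqP; rewrite eq_le maxi//=.
  have := maxi (enum_rank (delta (enum_val j) true)).
  have := maxi (enum_rank (delta (enum_val j) false)).
  have := ler_normD (x * v 0 (enum_rank (delta (enum_val j) true)))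
      ((1 - x) * v 0 (enum_rank (delta (enum_val j) false))).
  have := vE j; rewrite jlive => <-; rewrite jM !normrM.
  rewrite (gtr0_norm x0) (@gtr0_norm _ (1 - x)) ?subr_gt0//.
  by case: b; nra.
have ilive : live (enum_val i).
  by apply: contraT => /negPf il; move: M0; rewrite vE il normr0 ltxx.
by case/andP: ilive => _ /asboolP[w wF]; have := spread w i erefl; rewrite wF.
Qed.

End AutLang.

(** * Output probabilities as rational functions *)

Section AutProb.
Variables (R : realType) (S : finType) (delta : S -> bool -> S) (Fin : {set S}).

Implicit Types (x : R) (X : {set S}) (s : S) (w : seq bool).

Definition out_prob (x : R) (X : {set S}) (s : S) : R :=
  fine (lang_prob x (aut_lang s delta X Fin)).

Lemma out_probE x X s : 0 < x < 1 -> X \subset Fin ->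
  lang_prob x (aut_lang s delta X Fin) = (out_prob x X s)%:E.
Proof.
move=> /andP[x0 x1] XF; rewrite fineK//; apply: lang_prob_prefix_free_fin.
  by rewrite !ltW.
exact: prefix_free_aut_lang.
Qed.

(** At a final state the language is [[set [::]]] or empty, at a state that cannot reach [Fin] it is
    empty, and at a live state [lang_prob_step] conditions on the first letter. *)
Lemma out_prob_system x X : 0 < x < 1 -> X \subset Fin ->
  (\row_j out_prob x X (enum_val j)) *m transition_mx delta Fin x =
  \row_j (enum_val j \in X)%:R.
Proof.
move=> x01 XF; have x01' : 0 <= x <= 1 by case/andP: x01 => *; rewrite !ltW.
apply/rowP => j; rewrite mul_transition_mx !mxE !enum_rankK.
move: (enum_val j) => s; have [sF|sF] := boolP (s \in Fin).
  rewrite /live sF/= subr0 /out_prob.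
  have [sX|sX] := boolP (s \in X).
    rewrite (_ : aut_lang _ _ _ _ = [set [::]]) ?lang_prob_nil//.
    by apply/seteqP; split=> w /=; rewrite aut_lang_final//; case.
  rewrite (_ : aut_lang _ _ _ _ = set0) ?lang_prob0//.
  by apply/seteqP; split=> w //=; rewrite aut_lang_final// (negPf sX) => -[].
have -> : (s \in X) = false by apply/negbTE; apply: contra sF; exact: (fintype.subsetP XF).
case: ifPn => [_|]; last first.
  rewrite /live sF/= => /asboolPn noF; rewrite subr0 /out_prob.
  rewrite (_ : aut_lang _ _ _ _ = set0) ?lang_prob0//.
  apply/seteqP; split=> w //= -[wX _]; apply: noF; exists w.
  exact: (fintype.subsetP XF).
apply/eqP; rewrite subr_eq0; apply/eqP/EFin_inj.
rewrite EFinD !EFinM -!out_probE// lang_prob_step//; last first.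
  by move/aut_lang_nil/(fintype.subsetP XF); rewrite (negPf sF).
by congr (_ * lang_prob _ _ + _ * lang_prob _ _)%E; apply/seteqP;
  split=> w /=; rewrite aut_lang_cons.
Qed.

(** Cramer's rule over [{poly rat}], so that one fraction serves all [x] at once. *)
Definition out_den : {poly rat} := \det (transition_mx delta Fin 'X).

Definition out_num (X : {set S}) (s : S) : {poly rat} :=
  ((\row_j (enum_val j \in X)%:R) *m \adj (transition_mx delta Fin 'X))
    0 (enum_rank s).

(** [qeval] as a ring morphism, so that it commutes with determinants and adjugates. *)
Let eval (x : R) : {rmorphism {poly rat} -> R} := horner_eval x \o map_poly ratr.

Let evalX x : eval x 'X = x.
Proof. by rewrite /= /horner_eval map_polyX hornerX. Qed.

Lemma out_den_neq0 (x : R) : 0 < x < 1 -> qeval out_den x != 0.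
Proof.
move=> x01; rewrite -[qeval _ _]/(eval x out_den) /out_den -det_map_mx.
by rewrite map_transition_mx evalX transition_mx_det_neq0.
Qed.

Lemma out_prob_rational x X s : 0 < x < 1 -> X \subset Fin ->
  out_prob x X s = qeval (out_num X s) x / qeval out_den x.
Proof.
move=> x01 XF; apply: (canRL (mulfK (out_den_neq0 x01))).
rewrite -[qeval out_den _]/(eval x _) -[qeval _ _]/(eval x _).
rewrite /out_den -det_map_mx map_transition_mx evalX.
have := congr1 (fun A => (A *m \adj (transition_mx delta Fin x)) 0 (enum_rank s))
  (out_prob_system x01 XF).
rewrite -mulmxA mul_mx_adj -scalemx1 -scalemxAr mulmx1 !mxE enum_rankK mulrC => ->.
rewrite /out_num mxE rmorph_sum; apply: eq_bigr => i _.
rewrite rmorphM; congr (_ * _); first by rewrite !mxE rmorph_nat.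
by rewrite -{1}[x]evalX -map_transition_mx -map_mx_adj [LHS]mxE.
Qed.

End AutProb.

Lemma automaton_rational (R : realType) (D : set R) (f : R -> R) :
  D `<=` [set x | 0 < x < 1] -> D !=set0 -> (forall p, D p -> 0 < f p < 1) ->
  automaton_simulable D f -> rational_restriction D f.
Proof.
move=> D01 [p0 Dp0] f01 [S [s0 [delta [S0 [S1 [S01 [_ [_ [_ [_ sim]]]]]]]]]].
set Fin := S0 :|: S1 in sim.
have S0F : S0 \subset Fin by exact: finset.subsetUl.
have S1F : S1 \subset Fin by exact: finset.subsetUr.
have sum_out (x : R) : 0 < x < 1 ->
    lang_prob x (aut_lang s0 delta S0 Fin `|` aut_lang s0 delta S1 Fin) =
    (out_prob delta Fin x S0 s0 + out_prob delta Fin x S1 s0)%:E.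
  move=> x01; rewrite lang_probU ?aut_lang_disjoint//; last first.
    by case/andP: x01 => *; rewrite !ltW.
  by rewrite EFinD !out_probE.
have out1 p : D p -> out_prob delta Fin p S1 s0 = f p.
  by move=> Dp; apply/EFin_inj; rewrite -out_probE// ?(sim _ Dp).2//; exact: D01.
have out0 p : D p -> out_prob delta Fin p S0 s0 = 1 - f p.
  move=> Dp; have := (sim _ Dp).1; rewrite sum_out; last exact: D01.
  by case; rewrite out1// => <-; rewrite addrK.
(* Positivity at the single point [p0] gives a word in the language, and that word has positive
   probability at every [x] in (0,1). *)
have out_gt0 (X : {set S}) : X \subset Fin -> 0 < out_prob delta Fin p0 X s0 ->
    forall x, 0 < x < 1 -> 0 < out_prob delta Fin x X s0.
  move=> XF pos x x01; rewrite -lte_fin -out_probE//.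
  have [L0|/set0P[w Lw]] := eqVneq (aut_lang s0 delta X Fin) set0.
    by move: pos; rewrite /out_prob L0 lang_prob0 ltxx.
  exact: lang_prob_gt0 Lw.
have /andP[fp0 fp1] := f01 _ Dp0.
exists (out_num delta Fin S1 s0), (out_den delta Fin); split.
  move=> x x01; rewrite out_den_neq0//; split=> //.
  rewrite -out_prob_rational//.
  have pos1 : 0 < out_prob delta Fin x S1 s0 by apply: out_gt0; rewrite ?out1.
  have pos0 : 0 < out_prob delta Fin x S0 s0.
    by apply: out_gt0; rewrite ?out0// subr_gt0.
  (* Kraft's inequality bounds the sum of the two outputs also outside [D]; with [pos0] this keeps
     output 1 below 1. *)
  rewrite pos1/=; have : out_prob delta Fin x S0 s0 + out_prob delta Fin x S1 s0 <= 1.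
    rewrite -lee_fin -sum_out// -aut_langU kraft_le1//.
      by case/andP: x01 => *; rewrite !ltW.
    exact: prefix_free_aut_lang.
  lra.
by move=> p Dp; rewrite -out_prob_rational// ?out1//; exact: D01.
Qed.

(** * Block simulations as automata *)

Section BlockLang.
Variables (k : nat) (A' A : set (seq bool)).
Hypotheses (A'k : A' `<=` [set u | size u = k]) (Ak : A `<=` [set u | size u = k]).

Lemma block_lang_size w : block_lang A' A w -> (k <= size w)%N.
Proof. by case=> us [v [_ [/Ak/= <- ->]]]; rewrite size_cat leq_addl. Qed.

(** All blocks have length [k], so the first block of any decomposition is aligned with [u]. *)
Lemma block_lang_cat u w : size u = k ->
  block_lang A' A (u ++ w) <-> (A' u /\ block_lang A' A w) \/ (A u /\ w = [::]).
Proof.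
move=> uk; split=> [[us [v [usA' [Av]]]]|[[A'u [us [v [usA' [Av ->]]]]]|[Au ->]]].
- case: us usA' => [_ /eqP|u1 us usA']/=.
    rewrite -[v in _ == v]cats0 eqseq_cat; last by rewrite uk (Ak Av).
    by case/andP=> /eqP-> /eqP->; right.
  have A'u1 : A' u1 by apply: usA'; rewrite mem_head.
  rewrite -catA => /eqP; rewrite eqseq_cat; last by rewrite uk (A'k A'u1).
  case/andP=> /eqP-> /eqP->; left; split=> //; exists us, v; split=> //.
  by move=> u2 u2us; apply: usA'; rewrite inE u2us orbT.
- exists (u :: us), v; split; last by rewrite /= catA.
  by move=> u1; rewrite inE => /orP[/eqP->|/usA'].
- by exists [::], u; rewrite cats0.
Qed.

End BlockLang.

Lemma block_langU A' A B :
  block_lang A' (A `|` B) = block_lang A' A `|` block_lang A' B.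
Proof.
apply/seteqP; split=> w.
  by case=> us [v [usA' [[Av|Bv] wE]]]; [left|right]; exists us, v.
by case=> -[us [v [usA' [vAB wE]]]]; exists us, v; do 2?split=> //; [left|right].
Qed.

Section BlockAutomaton.
Variables (k : nat) (A0 A1 : set (seq bool)).
Hypotheses (k_gt0 : (0 < k)%N).
Hypotheses (A0k : A0 `<=` [set u | size u = k]) (A1k : A1 `<=` [set u | size u = k]).

Let A' : set (seq bool) := [set u | size u = k /\ ~ A0 u /\ ~ A1 u].

(** A full block of [A'] resets the state to the empty word; a full block of [A0] or [A1] is kept
    and absorbs. The extended word has length at most [k], so [insub_bseq] never falls back on its
    default. *)
Definition block_step (s : k.-bseq bool) (b : bool) : k.-bseq bool :=
  if size s == k then s
  else if `[< A' (rcons s b) >] then [bseq] else insub_bseq k (rcons s b).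

Definition block_states (A : set (seq bool)) : {set k.-bseq bool} :=
  [set s : k.-bseq bool | `[< A s >]].

Let Fin := block_states A0 :|: block_states A1.

Let A'k : A' `<=` [set u | size u = k].
Proof. by move=> u []. Qed.

Let FinE (s : k.-bseq bool) : s \in Fin <-> (A0 `|` A1) s.
Proof.
rewrite !inE; split; first by case/orP=> /asboolP; [left|right].
by case=> As; apply/orP; [left|right]; apply/asboolP.
Qed.

Lemma block_states_disjoint : A0 `&` A1 = set0 ->
  block_states A0 :&: block_states A1 = finset.set0.
Proof.
move=> A01; apply/setP => s; rewrite !inE; apply/negP => /andP[/asboolP A0s /asboolP A1s].
by rewrite -[False]/(set0 (val s)) -A01.
Qed.

Lemma block_step_absorbing A s b : A `<=` A0 `|` A1 ->
  s \in block_states A -> block_step s b \in block_states A.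
Proof.
move=> AA; rewrite /block_step inE => /asboolP As.
have -> : size s == k by apply/eqP; case: (AA _ As) => [/A0k|/A1k].
by rewrite inE; apply/asboolP.
Qed.

(** The start state is generalised to any partial block [s], for induction on the unread word
    [w]. *)
Lemma block_aut_lang_from A (s : k.-bseq bool) w : A `<=` A0 `|` A1 ->
  (size s < k)%N ->
  aut_lang s block_step (block_states A) Fin w <-> block_lang A' A (s ++ w).
Proof.
move=> AA; have Ak : A `<=` [set u | size u = k].
  by move=> u /AA[/A0k|/A1k].
elim: w s => [|b w IHw] s sk.
  rewrite cats0; split; last by move/(block_lang_size Ak); rewrite leqNgt sk.
  by case; rewrite inE => /asboolP/Ak/= sk'; move: sk; rewrite sk' ltnn.
have sF : s \notin Fin.
  by apply/negP => /FinE[/A0k|/A1k]/= sk'; move: sk; rewrite sk' ltnn.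
rewrite aut_lang_cons// -cat_rcons /block_step ltn_eqF//.
have val_s : val (insub_bseq k (rcons s b)) = rcons s b.
  by rewrite /insub_bseq val_insubd size_rcons sk.
move: sk; rewrite leq_eqVlt => /orP[/eqP sk|sk].
  have rk : size (rcons s b) = k by rewrite size_rcons.
  rewrite (block_lang_cat A'k Ak _ rk); case: asboolP => [A's|A's].
    rewrite IHw//=; split=> [?|[[]//|[As _]]]; first by left.
    by case: A's => _ [nA0 nA1]; case: (AA _ As).
  have A01s : (A0 `|` A1) (rcons s b).
    by apply: contrapT => /not_orP[nA0 nA1]; apply: A's.
  rewrite aut_lang_final; last by apply/FinE; rewrite val_s.
  rewrite inE -(rwP (asboolP _)) /= val_s.
  by split=> [[]|[[]|[]]]//; right.
case: asboolP => [[rk _]|_].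
  by have := ltn_eqF sk; rewrite -(size_rcons s b) rk eqxx.
by rewrite IHw ?val_s ?size_rcons.
Qed.

Lemma block_aut_lang A : A `<=` A0 `|` A1 ->
  aut_lang [bseq] block_step (block_states A) Fin = block_lang A' A.
Proof. by move=> AA; apply/seteqP; split=> w; rewrite block_aut_lang_from. Qed.

Lemma block_lang_disjoint : A0 `&` A1 = set0 ->
  block_lang A' A0 `&` block_lang A' A1 = set0.
Proof.
move=> A01; rewrite -!block_aut_lang//.
exact/aut_lang_disjoint/block_states_disjoint.
Qed.

Lemma prefix_free_block_lang A : A `<=` A0 `|` A1 ->
  prefix_free (block_lang A' A).
Proof.
move=> AA; rewrite -block_aut_lang//; apply: prefix_free_aut_lang.
by apply/fintype.subsetP => s; rewrite inE => /asboolP/AA/FinE.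
Qed.

End BlockAutomaton.

Lemma block_automaton (R : realType) (D : set R) (f : R -> R) :
  has_block_simulation D f -> automaton_simulable D f.
Proof.
case=> k [k0 [A0 [A1 [A0k [A1k [A01 sim]]]]]].
exists (k.-bseq bool), [bseq], (block_step A0 A1), (block_states k A0), (block_states k A1).
rewrite !block_aut_lang//.
split; [|split; [|split; last exact: sim]].
- exact: block_states_disjoint.
- by move=> s b; apply: block_step_absorbing => //; exact: subsetUl.
- by move=> s b; apply: block_step_absorbing => //; exact: subsetUr.
Qed.

(** * Bernstein coefficients of positive polynomials *)

Section BernsteinNonneg.
Implicit Types (g h : {poly int}) (n m : nat).

(** The basis carries no binomial factors and the coefficients are natural numbers, so that they can
    count words of a given weight. *)
Definition bernstein_nonneg g n : Prop := exists c : nat -> nat,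
  g = \sum_(j < n.+1) (c j)%:R *: ('X^j * (1 - 'X) ^+ (n - j)).

Lemma bernstein_nonneg_mulX g n :
  bernstein_nonneg g n -> bernstein_nonneg (g * 'X) n.+1.
Proof.
case=> c ->; exists (fun j => if j is i.+1 then c i else 0%N).
rewrite [RHS]big_ord_recl/= scale0r add0r mulr_suml; apply: eq_bigr => j _.
by rewrite /bump/= add1n subSS -scalerAl exprS; congr (_ *: _); ring.
Qed.

Lemma bernstein_nonneg_mul1subX g n :
  bernstein_nonneg g n -> bernstein_nonneg (g * (1 - 'X)) n.+1.
Proof.
case=> c ->; exists (fun j => if (j <= n)%N then c j else 0%N).
rewrite [RHS]big_ord_recr/= ltnn scale0r addr0 mulr_suml; apply: eq_bigr => j _.
rewrite -ltnS ltn_ord -scalerAl -mulrA -exprSr subSn// -ltnS; exact: ltn_ord.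
Qed.

Lemma bernstein_nonnegD g h n :
  bernstein_nonneg g n -> bernstein_nonneg h n -> bernstein_nonneg (g + h) n.
Proof.
case=> c -> [e ->]; exists (fun j => c j + e j)%N.
by rewrite -big_split/=; apply: eq_bigr => j _; rewrite natrD scalerDl.
Qed.

(** Degree elevation by [g = g * 'X + g * (1 - 'X)]. *)
Lemma bernstein_nonneg_le g n m : (n <= m)%N ->
  bernstein_nonneg g n -> bernstein_nonneg g m.
Proof.
move=> /subnKC <-; elim: (m - n)%N => [|k IHk] gn; first by rewrite addn0.
rewrite addnS; have -> : g = g * 'X + g * (1 - 'X) by ring.
apply: bernstein_nonnegD.
  exact/bernstein_nonneg_mulX/IHk.
exact/bernstein_nonneg_mul1subX/IHk.
Qed.

End BernsteinNonneg.

Section BernsteinCoef.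

(** The guard is there because truncated subtraction would make the binomial equal to 1 for
    [j < i]. *)
Definition monomial_bcoef (n i j : nat) : nat :=
  if (i <= j)%N then 'C(n - i, j - i) else 0%N.

(** Binomial expansion of ['X^i * ((1 - 'X) + 'X) ^+ (n - i)], reindexed by [i]. *)
Lemma monomial_bernstein (K : comNzRingType) (n i : nat) : (i <= n)%N ->
  'X^i = \sum_(j < n.+1) (monomial_bcoef n i j)%:R *: ('X^j * (1 - 'X) ^+ (n - j))
  :> {poly K}.
Proof.
move=> i_n; rewrite -(big_mkord xpredT (fun j =>
  (monomial_bcoef n i j)%:R *: ('X^j * (1 - 'X) ^+ (n - j)))).
rewrite (@big_cat_nat _ _ _ i)//=; last exact: leqW.
rewrite [X in X + _]big_nat big1 ?add0r; last first.
  by move=> j /andP[_ ji]; rewrite /monomial_bcoef leqNgt ji scale0r.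
rewrite -[X in \sum_(X <= _ < _) _]add0n big_addn subSn// big_mkord.
rewrite -[LHS]mulr1 -[in LHS](expr1n _ (n - i)%N) -{1}[1](subrK 'X) exprDn mulr_sumr.
apply: eq_bigr => l _; rewrite /monomial_bcoef leq_addl addnK exprD subnDA [(n - l - i)%N]subnAC.
by rewrite scaler_nat mulrnAr; congr (_ *+ _); ring.
Qed.

Definition bernstein_coef (K : comNzRingType) (p : {poly K}) (n j : nat) : K :=
  \sum_(i < size p) p`_i * (monomial_bcoef n i j)%:R.

Lemma bernstein_coefE (K : comNzRingType) (p : {poly K}) n : (size p <= n)%N ->
  p = \sum_(j < n.+1) bernstein_coef p n j *: ('X^j * (1 - 'X) ^+ (n - j)).
Proof.
move=> pn; rewrite -[LHS]coefK poly_def.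
under eq_bigr => i _.
  rewrite (@monomial_bernstein _ n i) ?(leq_trans (ltnW (ltn_ord i)))//.
  rewrite scaler_sumr; over.
rewrite exchange_big/=; apply: eq_bigr => j _.
by rewrite scaler_suml; apply: eq_bigr => i _; rewrite scalerA.
Qed.

End BernsteinCoef.

(** * Positivity of Bernstein coefficients in high degree *)

Section BernsteinPositive.
Variable R : realType.

Definition bcoef_ratio (n i j : nat) : R :=
  (monomial_bcoef n i j)%:R / 'C(n, j)%:R.

(** The absorption identity [mul_bin_diag]; for [j <= i] both sides are 0. *)
Lemma bcoef_ratioS n i j : (j <= n)%N -> (i < n)%N ->
  bcoef_ratio n i.+1 j = bcoef_ratio n i j * ((j - i)%:R / (n - i)%:R).
Proof.
move=> jn i_n; rewrite /bcoef_ratio /monomial_bcoef.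
have [ij|ji] := ltnP i j; last first.
  by rewrite (eqP (ji : j - i == 0)%N) !mul0r mulr0.
rewrite (ltnW ij) mulrAC; congr (_ / _).
rewrite mulrA; apply: (canRL (mulfK _)); first by rewrite pnatr_eq0 subn_eq0 -ltnNge.
rewrite -!natrM; congr (_%:R).
have := mul_bin_diag (n - i) (j - i.+1).
by rewrite subnSK// -subnS mulnC => ->; rewrite mulnC.
Qed.

(* The ratio is a quotient of falling factorials j(j-1).../n(n-1)..., which
   tends to (j/n)^i uniformly in j. *)
Lemma bcoef_ratio_approx n d i j : (j <= n)%N -> (d < n)%N -> (i <= d)%N ->
  0 <= bcoef_ratio n i j <= 1 /\
  `|bcoef_ratio n i j - (j%:R / n%:R) ^+ i| <= i%:R * (d%:R / (n - d)%:R).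
Proof.
move=> jn dn; have n0 : (0 < n)%N by case: n dn {jn}.
elim: i => [_|i IHi id].
  rewrite /bcoef_ratio /monomial_bcoef !subn0 divff ?pnatr_eq0 -?lt0n ?bin_gt0//.
  by rewrite expr0 subrr normr0 mul0r ler01 lexx.
have [/andP[r0 r1] IH] := IHi (ltnW id).
rewrite bcoef_ratioS//; last exact: leq_ltn_trans (ltnW id) dn.
set t := j%:R / n%:R; set e := d%:R / (n - d)%:R in IH *.
set q := (j - i)%:R / (n - i)%:R; set r := bcoef_ratio n i j in r0 r1 IH *.
have n_gt0 : 0 < n%:R :> R by rewrite ltr0n.
have ni_gt0 : 0 < (n - i)%:R :> R by rewrite ltr0n subn_gt0 (ltn_trans id).
have nd_gt0 : 0 < (n - d)%:R :> R by rewrite ltr0n subn_gt0.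
have t01 : 0 <= t <= 1.
  by rewrite divr_ge0//= ler_pdivrMr// mul1r ler_nat.
have q01 : 0 <= q <= 1.
  by rewrite divr_ge0//= ler_pdivrMr// mul1r ler_nat leq_sub2r.
(* For [i <= j] the difference [t - q] is [i * (1 - t) / (n - i)]; otherwise [q] is 0 and [t] is at
   most [i / n]. Both are at most [e]. *)
have qt : `|q - t| <= e.
  have e_nd : e * (n%:R - d%:R) = d%:R by rewrite -natrB 1?ltnW// divfK ?gt_eqF.
  have e0 : 0 <= e by rewrite divr_ge0.
  have t_n : t * n%:R = j%:R by rewrite divfK ?gt_eqF.
  have id' : i%:R <= d%:R :> R by rewrite ler_nat ltnW.
  have jn' : j%:R <= n%:R :> R by rewrite ler_nat.
  have d_n' : d%:R <= n%:R :> R by rewrite ler_nat ltnW.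
  have i0 : 0 <= i%:R :> R by [].
  have [ij|ji] := leqP i j.
    have q_n : q * (n%:R - i%:R) = j%:R - i%:R.
      by rewrite -!natrB// 1?ltnW// ?divfK ?gt_eqF// (ltn_trans id).
    have ni_gt0' : 0 < n%:R - i%:R :> R by rewrite -natrB// ltnW// (ltn_trans id).
    case/andP: t01 => t0 t1; case/andP: q01 => q0 q1.
    have qtE : (t - q) * (n%:R - i%:R) = i%:R * (1 - t) by rewrite mulrBl q_n mulrBr t_n; ring.
    have tq : 0 <= t - q by rewrite -(pmulr_lge0 _ ni_gt0') qtE mulr_ge0// subr_ge0.
    rewrite distrC ger0_norm// -(ler_pM2r ni_gt0') qtE.
    have : i%:R * (1 - t) <= i%:R by rewrite ler_piMr// gerBl.
    have : e * (n%:R - d%:R) <= e * (n%:R - i%:R) by rewrite ler_wpM2l// lerB.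
    by rewrite e_nd; lra.
  have -> : q = 0 by rewrite /q (eqP (ltnW ji : j - i == 0)%N) mul0r.
  case/andP: t01 => t0 t1; rewrite sub0r normrN ger0_norm// -(ler_pM2r n_gt0) t_n.
  have : j%:R <= i%:R :> R by rewrite ler_nat ltnW.
  have : e * (n%:R - d%:R) <= e * n%:R by rewrite ler_wpM2l// gerBl.
  by rewrite e_nd; lra.
case/andP: t01 => t0 t1; case/andP: q01 => q0 q1.
split; first by rewrite mulr_ge0//= mulr_ile1.
(* As [r] and [t] lie in [0,1], the error of the new factor is simply added to the inherited one. *)
rewrite exprS (_ : r * q - t * t ^+ i = r * (q - t) + t * (r - t ^+ i)); last by ring.
rewrite (le_trans (ler_normD _ _))// (normrM r) (normrM t) (ger0_norm r0) (ger0_norm t0).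
rewrite -natr1 mulrDl mul1r addrC lerD//.
  by rewrite (le_trans _ IH)// ler_piMl.
by rewrite (le_trans _ qt)// ler_piMl.
Qed.

Lemma poly_min01 (p : {poly R}) : (forall x, 0 <= x <= 1 -> 0 < p.[x]) ->
  exists2 mu, 0 < mu & forall x, 0 <= x <= 1 -> mu <= p.[x].
Proof.
move=> p0; have cp : {within `[0, 1], continuous (horner p)}.
  by apply: continuous_subspaceT => x; exact: continuous_horner.
have [c c01 pc] := EVT_min ler01 cp.
by exists p.[c] => [|x x01]; [apply: p0|apply: pc].
Qed.

(** Divided by ['C(n, j)], the coefficient is the value of [p] at [j / n] plus an error of order
    [1 / n] uniform in [j], while [p] is bounded below by [mu]. *)
Lemma bernstein_coef_gt0 (p : {poly R}) : (forall x, 0 <= x <= 1 -> 0 < p.[x]) ->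
  exists2 n, (size p <= n)%N & forall j, (j <= n)%N -> 0 < bernstein_coef p n j.
Proof.
move=> p0; have [mu mu0 p_mu] := poly_min01 p0.
pose d := size p; pose M := \sum_(i < d) `|p`_i|.
(* Chosen so that [K < n - d] brings the error bound [M * (d * (d / (n - d)))] below [mu]. *)
pose K := d%:R * (M * d%:R) / mu.
have K0 : 0 <= K by rewrite !mulr_ge0// ?invr_ge0 ?(ltW mu0)// sumr_ge0.
exists (d + (Num.truncn K).+1)%N; first exact: leq_addr.
set n := (d + _)%N => j jn.
have dn : (d < n)%N by rewrite /n addnS ltnS leq_addr.
have n0 : 0 < n%:R :> R by rewrite ltr0n (leq_trans _ dn).
have nd_gt0 : 0 < (n - d)%:R :> R by rewrite ltr0n subn_gt0.
have ndK : K < (n - d)%:R by rewrite /n addnC addnK truncnS_gt.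
have C0 : 0 < 'C(n, j)%:R :> R by rewrite ltr0n bin_gt0.
set t : R := j%:R / n%:R.
have t01 : 0 <= t <= 1 by rewrite divr_ge0//= ler_pdivrMr// mul1r ler_nat.
have -> : bernstein_coef p n j =
    'C(n, j)%:R * \sum_(i < d) p`_i * bcoef_ratio n i j.
  rewrite mulr_sumr; apply: eq_bigr => i _; rewrite /bcoef_ratio.
  by rewrite mulrCA [_ * (_ / _)]mulrC divfK ?gt_eqF.
rewrite mulr_gt0//.
have -> : \sum_(i < d) p`_i * bcoef_ratio n i j =
    p.[t] + \sum_(i < d) p`_i * (bcoef_ratio n i j - t ^+ i).
  by rewrite horner_coef -big_split/=; apply: eq_bigr => i _; rewrite mulrBr addrC subrK.
set E := \sum_(i < d) p`_i * (_ - _).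
have E_le : `|E| <= M * (d%:R * (d%:R / (n - d)%:R)).
  rewrite (le_trans (ler_norm_sum _ _ _))// mulr_suml ler_sum// => i _.
  have [_ ri] := bcoef_ratio_approx jn dn (ltnW (ltn_ord i)).
  rewrite normrM ler_wpM2l// (le_trans ri)// ler_wpM2r ?divr_ge0//.
  by rewrite ler_nat ltnW.
have E_mu : `|E| < mu.
  rewrite (le_lt_trans E_le)// (_ : _ * _ = d%:R * (M * d%:R) / (n - d)%:R); last by ring.
  by rewrite ltr_pdivrMr// [ltRHS]mulrC -ltr_pdivrMr.
by have := p_mu _ t01; have := ler_norm (- E); rewrite normrN; lra.
Qed.

End BernsteinPositive.

Lemma bernstein_coef_map (R K : comNzRingType) (f : {rmorphism R -> K})
    (p : {poly R}) n j : injective f ->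
  bernstein_coef (map_poly f p) n j = f (bernstein_coef p n j).
Proof.
move=> f_inj; rewrite /bernstein_coef rmorph_sum size_map_inj_poly ?rmorph0//.
by apply: eq_bigr => i _; rewrite coef_map rmorphM rmorph_nat.
Qed.

(** Induction on the size: a root at 0 or 1 is divided out, leaving a quotient positive on (0,1).
    Without such roots the polynomial is positive on [0,1] and [bernstein_coef_gt0] applies. *)
Lemma bernstein_nonneg_pos (R : realType) (g : {poly int}) :
  (forall x : R, 0 < x < 1 -> 0 < (map_poly intr g).[x]) ->
  exists n, bernstein_nonneg g n.
Proof.
move: {2}(size g) (leqnn (size g)) => m.
elim: m g => [|m IHm] g gm g0.
  move: gm; rewrite leqn0 size_poly_eq0 => /eqP->.
  exists 0%N, (fun=> 0%N); by rewrite big1// => j _; rewrite scale0r.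
have pos (q h : {poly int}) : g = q * h ->
    (forall x : R, 0 < x < 1 -> 0 < (map_poly intr h).[x]) ->
  forall x : R, 0 < x < 1 -> 0 < (map_poly intr q).[x].
  move=> gE h0 x x01; rewrite -(pmulr_lgt0 _ (h0 x x01)) -hornerM -rmorphM/= -gE.
  exact: g0.
have g_neq0 : g != 0.
  apply/eqP => gE; have := g0 2^-1; rewrite gE rmorph0 horner0 ltxx.
  by rewrite invr_gt0 ltr0n invf_lt1 ?ltr1n ?ltr0n// => /(_ isT).
have [/factor_theorem[q gE]|g00] := boolP (root g 0).
  rewrite subr0 in gE.
  have q_neq0 : q != 0 by apply: contraNneq g_neq0 => q0; rewrite gE q0 mul0r.
  have qm : (size q <= m)%N by move: gm; rewrite gE size_mulX.
  have [|n qn] := IHm q qm.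
    by apply: (pos _ _ gE) => x /andP[x0 _]; rewrite map_polyX hornerX.
  by exists n.+1; rewrite gE; exact: bernstein_nonneg_mulX.
have [/factor_theorem[q gE]|g10] := boolP (root g 1).
  (* The factor theorem yields ['X - 1], negative on (0,1); its sign moves into the quotient. *)
  have {}gE : g = (- q) * (1 - 'X) by rewrite gE mulNr -mulrN opprB.
  have q_neq0 : - q != 0 by apply: contraNneq g_neq0 => q0; rewrite gE q0 mul0r.
  have qm : (size (- q)%R <= m)%N.
    move: q_neq0 gm; rewrite oppr_eq0 gE size_polyN mulNr -mulrN opprB => q_neq0.
    by rewrite size_Mmonic ?monicXsubC// size_XsubC addn2.
  have [|n qn] := IHm (- q) qm.
    apply: (pos _ _ gE) => x /andP[_ x1].
    by rewrite rmorphB rmorph1/= map_polyX hornerD hornerN hornerX hornerC subr_gt0.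
  by exists n.+1; rewrite gE; exact: bernstein_nonneg_mul1subX.
set G : {poly R} := map_poly intr g.
have G_int (z : int) : ~~ root g z -> G.[z%:~R] != 0.
  by rewrite /root horner_map intr_eq0.
have G_neq0 x : 0 <= x <= 1 -> G.[x] != 0.
  move=> /andP[]; rewrite le_eqVlt => /orP[/eqP<- _|x0]; first exact: (G_int 0).
  rewrite le_eqVlt => /orP[/eqP->|x1]; first exact: (G_int 1).
  by rewrite gt_eqF// g0 ?x0.
have half01 : 0 <= (2^-1 : R) <= 1 by rewrite invr_ge0 ler0n invf_le1 ?ler1n ?ltr0n.
have G_pos x : 0 <= x <= 1 -> 0 < G.[x].
  move=> x01; rewrite lt_neqAle eq_sym G_neq0//= leNgt; apply/negP => Gx.
  have Gh : 0 < G.[2^-1].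
    by apply: g0; rewrite invr_gt0 ltr0n invf_lt1 ?ltr1n ?ltr0n.
  have noroot y : 0 <= y <= 1 -> ~ root G y.
    by move=> y01; rewrite /root (negPf (G_neq0 _ y01)).
  case/andP: x01 => x0 x1; case/andP: half01 => h0 h1.
  have [xh|hx] := leP x 2^-1.
    have [|y /andP[y0 y1]] := @poly_ivt _ G x 2^-1 xh; first by rewrite !ltW.
    by apply: noroot; rewrite (le_trans x0)//= (le_trans y1).
  (* [poly_ivt] wants an upward sign change, hence [- G] to the right of one half. *)
  have [|y /andP[y0 y1]] := @poly_ivt _ (- G) 2^-1 x (ltW hx).
    by rewrite !hornerN oppr_le0 oppr_ge0 !ltW.
  by rewrite rootN; apply: noroot; rewrite (le_trans h0)//= (le_trans y1).
have [n Gn c0] := bernstein_coef_gt0 G_pos.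
have gn : (size g <= n)%N by rewrite (leq_trans _ Gn)// size_map_inj_poly//; exact: intr_inj.
exists n, (fun j => `|bernstein_coef g n j|%N).
rewrite [LHS](bernstein_coefE gn); apply: eq_bigr => j _; congr (_ *: _).
have : 0 < bernstein_coef g n j.
  have := c0 j; rewrite -ltnS ltn_ord => /(_ isT).
  by rewrite /G bernstein_coef_map ?ltr0z//; exact: intr_inj.
by move=> /gtr0_norm {1}<-; rewrite -abszE natz.
Qed.

(** * Block simulations of rational functions *)

Section Weights.
Variable k : nat.
Implicit Types (t : k.-tuple bool) (X : {set k.-tuple bool}).

Definition weight_class i : {set k.-tuple bool} :=
  [set t : k.-tuple bool | count id t == i]%SET.

(** A tuple corresponds to its set of positions holding [true]; [card_draws] counts these sets. *)
Lemma card_weight_class i : #|weight_class i| = 'C(k, i).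
Proof.
rewrite -[in RHS](card_ord k) -card_draws.
pose F (B : {set 'I_k}) : k.-tuple bool := [tuple j \in B | j < k].
pose G t : {set 'I_k} := [set j | tnth t j]%SET.
have FK : cancel F G by move=> B; apply/setP => j; rewrite inE tnth_mktuple.
have GK : cancel G F by move=> t; apply: eq_from_tnth => j; rewrite tnth_mktuple inE.
rewrite -(card_imset _ (can_inj FK)); apply: eq_card => t.
rewrite !inE; apply/idP/imsetP => [ti|[B]].
  exists (G t); last by rewrite GK.
  rewrite inE -(eqP ti) cardsE -sum1_card -sum1_count big_tuple.
  by apply/eqP/eq_bigl => j.
rewrite inE => Bi ->; rewrite -(eqP Bi) -sum1_card -sum1_count big_tuple.
by apply/eqP/eq_bigl => j; rewrite tnth_mktuple.
Qed.

Lemma sum_word_prob (R : realType) (p : R) X :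
  \sum_(t in X) word_prob p t =
  \sum_(i < k.+1) #|X :&: weight_class i|%:R * (p ^+ i * (1 - p) ^+ (k - i)).
Proof.
have wtk t : (count id t < k.+1)%N by rewrite ltnS -[leqRHS](size_tuple t) count_size.
rewrite (partition_big (fun t => Ordinal (wtk t)) xpredT)//=.
apply: eq_bigr => i _; rewrite -sum1_card natr_sum mulr_suml.
apply: congr_big => // t; first by rewrite !inE -val_eqE.
move=> /andP[_ /eqP <-]; rewrite mul1r /word_prob /=; congr (_ * _ ^+ _).
by rewrite -[count negb t](addKn (count id t)) (count_predC id) size_tuple.
Qed.

Lemma sum_word_prob1 (R : realType) (p : R) :
  \sum_(t : k.-tuple bool) word_prob p t = 1.
Proof.
transitivity (\sum_(t in [set: k.-tuple bool]%SET) word_prob p t).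
  by apply: eq_bigl => t; rewrite inE.
rewrite sum_word_prob -[RHS](expr1n _ k) -{3}[1](subrK p) exprDn.
by apply: eq_bigr => i _; rewrite finset.setTI card_weight_class mulr_natl mulrC.
Qed.

(** In an enumeration of each weight class, [X] takes the first [a i] words and [Y] the next
    [b i]. *)
Lemma prescribed_weights (a b : nat -> nat) :
  (forall i, (i <= k)%N -> a i + b i <= 'C(k, i))%N ->
  exists X Y : {set k.-tuple bool}, [/\ X :&: Y = finset.set0,
    (forall i, (i <= k)%N -> #|X :&: weight_class i| = a i) &
    (forall i, (i <= k)%N -> #|Y :&: weight_class i| = b i)].
Proof.
move=> ab; pose W i := enum (weight_class i).
have W_uniq i : uniq (W i) by exact: enum_uniq.
have sizeW i : size (W i) = 'C(k, i) by rewrite -cardE card_weight_class.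
have memW t i : t \in W i -> count id t = i.
  by rewrite mem_enum inE => /eqP.
exists [set t : k.-tuple bool | t \in take (a (count id t)) (W (count id t))]%SET.
exists [set t : k.-tuple bool |
  t \in take (b (count id t)) (drop (a (count id t)) (W (count id t)))]%SET.
split.
- apply/setP => t; rewrite !inE; apply/negP => /andP[tX /mem_take tY].
  have := W_uniq (count id t); rewrite -[W _](cat_take_drop (a (count id t))).
  by rewrite cat_uniq => /and3P[_ /hasPn/(_ _ tY)]; rewrite /= tX.
- move=> i ik; have ai : size (take (a i) (W i)) = a i.
    by rewrite size_takel// sizeW (leq_trans _ (ab i ik))// leq_addr.
  rewrite -[RHS]ai -(card_uniqP (take_uniq _ (W_uniq i))); apply: eq_card => t.
  rewrite !inE; apply/andP/idP => [[tX /eqP<-]//|tW].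
  by rewrite (memW _ _ (mem_take tW)).
- move=> i ik; have bi : size (take (b i) (drop (a i) (W i))) = b i.
    by rewrite size_takel// size_drop sizeW leq_subRL ?ab// (leq_trans _ (ab i ik))// leq_addr.
  rewrite -[RHS]bi -(card_uniqP (take_uniq _ (drop_uniq _ (W_uniq i)))).
  apply: eq_card => t; rewrite !inE; apply/andP/idP => [[tX /eqP<-]//|tW].
  by rewrite (memW _ _ (mem_drop (mem_take tW))).
Qed.

End Weights.

(** * Probability of a block language *)

Section BlockProb.
Variables (R : realType) (p : R) (k : nat) (X0 X1 : {set k.-tuple bool}).
Hypotheses (p01 : 0 < p < 1) (k_gt0 : (0 < k)%N).

Definition tuple_words (X : {set k.-tuple bool}) : set (seq bool) :=
  [set w | exists2 t, t \in X & w = tval t].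

Lemma tuple_words_size X : tuple_words X `<=` [set u | size u = k].
Proof. by move=> _ [t _ ->]; rewrite /= size_tuple. Qed.

Lemma tuple_wordsE X (t : k.-tuple bool) : tuple_words X t <-> t \in X.
Proof. by split=> [[u uX /val_inj->]|tX]//; exists t. Qed.

Lemma tuple_words_disjoint : X0 :&: X1 = finset.set0 ->
  tuple_words X0 `&` tuple_words X1 = set0.
Proof.
move=> X01; apply/seteqP; split=> // _ [[t t0 ->] /tuple_wordsE t1].
by have := finset.in_set0 t; rewrite -X01 inE t0 t1.
Qed.

Let A' : set (seq bool) :=
  [set u | size u = k /\ ~ tuple_words X0 u /\ ~ tuple_words X1 u].

(** Conditioning on the first block gives a renewal equation: [g] is the weight of [X] plus [g]
    times the weight of the discarded blocks, and all weights sum to 1. The product form avoids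
    dividing extended reals. *)
Lemma lang_prob_block (X : {set k.-tuple bool}) : X \subset X0 :|: X1 ->
  (lang_prob p (block_lang A' (tuple_words X)) *
    (\sum_(t in X0 :|: X1) word_prob p t)%:E = (\sum_(t in X) word_prob p t)%:E)%E.
Proof.
move=> /fintype.subsetP XX; have p01' : 0 <= p <= 1.
  by case/andP: p01 => *; rewrite !ltW.
have A'k : A' `<=` [set u | size u = k] by move=> u [].
set L := block_lang A' _.
have A'E (t : k.-tuple bool) : A' t <-> t \notin X0 :|: X1.
  rewrite inE negb_or; split.
    by case=> _ [n0 n1]; apply/andP; split; apply/negP => /tuple_wordsE.
  by case/andP=> /negP n0 /negP n1; split; [rewrite size_tuple|split=> /tuple_wordsE].
have Lfin : lang_prob p L \is a fin_num.
  apply: lang_prob_prefix_free_fin => //; apply: prefix_free_block_lang => //.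
  - exact: tuple_words_size.
  - exact: tuple_words_size.
  - by move=> _ [t /XX + ->]; rewrite inE => /orP[]; [left|right]; exists t.
rewrite -(fineK Lfin); set g := fine _.
suff : g = \sum_(t in X) word_prob p t + \sum_(t in ~: (X0 :|: X1)) word_prob p t * g.
  rewrite -mulr_suml => gE; rewrite -EFinM; congr _%:E; move: gE.
  have := @sum_word_prob1 k R p; rewrite (bigID (mem (X0 :|: X1)))/=.
  rewrite [X in _ + X = _](eq_bigl (fun t => t \in ~: (X0 :|: X1))); last first.
    by move=> t; rewrite [RHS]finset.in_setC.
  move: (\sum_(i in X0 :|: X1) _) (\sum_(i in ~: _) _) (\sum_(i in X) _) => a b c ab gE.
  have -> : a = 1 - b by lra.
  rewrite mulrBr mulr1 {1}gE; ring.
apply: EFin_inj; rewrite EFinD {1}/g (fineK Lfin).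
rewrite (@lang_prob_split _ _ p01' (k.-tuple bool) (@tval k bool) L); last 2 first.
- move=> t u v w /eqP; rewrite eqseq_cat ?size_tuple// => /andP[/eqP /val_inj].
  by [].
- move=> w /(block_lang_size (@tuple_words_size X)) kw.
  have tk : size (take k w) == k by rewrite size_takel.
  by exists (Tuple tk), (drop k w); rewrite cat_take_drop.
rewrite -!sumEFin [X in (X + _)%E]big_mkcond [X in (_ + X)%E]big_mkcond.
rewrite -big_split/=; apply: eq_bigr => t _.
(* After a block of [X] only the empty word remains, after a discarded block the reading starts
   afresh, and after any other block nothing is left. *)
have -> : [set w | L (t ++ w)] = if t \in X then [set [::]]
    else if t \in ~: (X0 :|: X1) then L else set0.
  apply/seteqP; split=> w /=;
    rewrite /L (block_lang_cat A'k (@tuple_words_size X) _ (size_tuple t)).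
    rewrite A'E tuple_wordsE; case=> [[tX Lw]|[-> ->]]//.
    by rewrite inE tX; case: ifP => // /XX; rewrite (negPf tX).
  rewrite A'E tuple_wordsE; case: ifP => [_ ->|_]; first by right.
  by rewrite inE; case: ifP => // tX Lw; left.
case: ifPn => [/XX tX|tX].
  by rewrite lang_prob_nil// inE tX/= mule1 adde0.
case: ifPn => [_|_]; last by rewrite lang_prob0 mule0 adde0.
by rewrite add0e [RHS]EFinM /g fineK.
Qed.

End BlockProb.

(** In the step, Pascal's rule adds a positive entry to one that is at least [n]. This makes
    interior weight classes large enough. *)
Lemma leq_bin_interior n j : (0 < j < n)%N -> (n <= 'C(n, j))%N.
Proof.
elim: n j => [|n IHn] [|j]//= /[!ltnS] jn; rewrite binS.
case: j jn => [|j] jn; first by rewrite bin0 bin1 addn1.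
by rewrite -addn1 addnC leq_add ?IHn// bin_gt0.
Qed.

(** The factor [(x * (1 - x)) ^+ m] pads the coefficients with [m] zeros at either end. *)
Lemma bernstein_shift (R : comNzRingType) (c : nat -> nat) (n m : nat) (x : R) :
  \sum_(i < (n + m + m).+1)
    (if (m <= i <= n + m)%N then c (i - m)%N else 0%N)%:R
      * (x ^+ i * (1 - x) ^+ (n + m + m - i)) =
  (x * (1 - x)) ^+ m * \sum_(j < n.+1) (c j)%:R * (x ^+ j * (1 - x) ^+ (n - j)).
Proof.
rewrite -(big_mkord xpredT (fun i =>
  (if (m <= i <= n + m)%N then c (i - m)%N else 0%N)%:R
      * (x ^+ i * (1 - x) ^+ (n + m + m - i)))).
rewrite (@big_cat_nat _ _ _ m)//=; last by rewrite -addnA addnCA leqW ?leq_addr.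
rewrite [X in X + _]big_nat big1 ?add0r; last first.
  by move=> i /andP[_ im]; rewrite leqNgt im mul0r.
rewrite (@big_cat_nat _ _ _ (n + m).+1)//=; last 2 first.
- by rewrite leqW ?leq_addl.
- by rewrite ltnS leq_addr.
rewrite [X in _ + X]big_nat [X in _ + X]big1 ?addr0; last first.
  by move=> i /andP[im _]; rewrite [(i <= n + m)%N]leqNgt im andbF mul0r.
rewrite -[X in \sum_(X <= _ < _) _]add0n big_addn subSn ?leq_addl// addnK big_mkord.
rewrite mulr_sumr; apply: eq_bigr => j _.
have jn : (j <= n)%N by rewrite -ltnS.
rewrite leq_addl leq_add2r jn/= addnK exprD exprMn.
have -> : (n + m + m - (j + m) = (n - j) + m)%N by lia.
by rewrite exprD; ring.
Qed.

(* Multiplying numerator and denominator by (x(1-x))^m leaves the fraction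
   unchanged but moves the coefficients to interior weights, where the number
   of available words exceeds them once m is large. *)
Lemma bernstein_block_simulation (R : realType) (D : set R) (f : R -> R)
    (N M : {poly int}) (n : nat) :
  D `<=` [set x | 0 < x < 1] ->
  bernstein_nonneg N n -> bernstein_nonneg M n ->
  (forall p, D p -> 0 < (map_poly intr (N + M)).[p] /\
    f p * (map_poly intr (N + M)).[p] = (map_poly intr N).[p]) ->
  has_block_simulation D f.
Proof.
move=> D01 [c NE] [e ME] fE.
(* [m] dominates every [c j + e j], and the successor makes it positive. Weights from [m] to [n + m]
   are thus interior for blocks of length [k = n + m + m], and each has at least [k >= m] words. *)
pose m := (\sum_(j < n.+1) (c j + e j)).+1%N.
have ce_m j : (j < n.+1)%N -> (c j + e j <= m)%N.
  by move=> jn; rewrite ltnW// /m ltnS (bigD1 (Ordinal jn))//= leq_addr.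
pose shift (c : nat -> nat) i := if (m <= i <= n + m)%N then c (i - m)%N else 0%N.
set k := (n + m + m)%N.
(* [X1] realises the numerator [N] and [X0] the complement [M], so together they realise the
   denominator. *)
have [|X1 [X0 [X10 X1c X0e]]] := @prescribed_weights k (shift c) (shift e).
  move=> i ik; rewrite /shift; case: ifP => // /andP[mi inm].
  apply: (@leq_trans m).
    have jn : (i - m < n.+1)%N by rewrite ltnS leq_subLR addnC.
    exact: ce_m.
  apply: leq_trans (leq_bin_interior _); first by rewrite leq_addl.
  by apply/andP; split; rewrite /k; move: mi inm; rewrite /m; lia.
have X01 : X0 :&: X1 = finset.set0 by rewrite finset.setIC.
have k_gt0 : (0 < k)%N by rewrite /k /m addnS.
have horner_int (g : {poly int}) (b : nat -> nat) (p : R) :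
    g = \sum_(j < n.+1) (b j)%:R *: ('X^j * (1 - 'X) ^+ (n - j)) ->
  (map_poly intr g).[p] = \sum_(j < n.+1) (b j)%:R * (p ^+ j * (1 - p) ^+ (n - j)).
  move=> ->; rewrite rmorph_sum horner_sum; apply: eq_bigr => j _ /=.
  rewrite map_polyZ/= hornerZ rmorph_nat rmorphM !rmorphXn rmorphB rmorph1/= map_polyX.
  by rewrite !hornerE.
have sumX X b p (g : {poly int}) :
    (forall i, (i <= k)%N -> #|X :&: weight_class k i| = shift b i) ->
    g = \sum_(j < n.+1) (b j)%:R *: ('X^j * (1 - 'X) ^+ (n - j)) ->
  \sum_(t in X) word_prob p t = (p * (1 - p)) ^+ m * (map_poly intr g).[p] :> R.
  move=> Xb gE; rewrite sum_word_prob (horner_int _ b p gE) -bernstein_shift.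
  by apply: eq_bigr => i _; rewrite Xb// -ltnS.
have sumX01 (p : R) : \sum_(t in X0 :|: X1) word_prob p t =
    (p * (1 - p)) ^+ m * (map_poly intr (N + M)).[p].
  rewrite rmorphD hornerD mulrDr -(sumX _ c p N X1c NE) -(sumX _ e p M X0e ME).
  rewrite addrC -bigU/=; last by rewrite -finset.setI_eq0 X01.
  by apply: eq_bigl => t; rewrite !inE.
exists k; split=> //; exists (tuple_words X0), (tuple_words X1).
split; first exact: tuple_words_size.
split; first exact: tuple_words_size.
split; first exact: tuple_words_disjoint.
split; first by apply: block_lang_disjoint => //;
  [exact: tuple_words_size..|exact: tuple_words_disjoint].
rewrite -block_langU; split.
  by apply: prefix_free_block_lang => //; exact: tuple_words_size.
move=> p Dp; have p01 := D01 _ Dp; have [NM fNM] := fE _ Dp.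
have S0 : 0 < \sum_(t in X0 :|: X1) word_prob p t.
  by rewrite sumX01 mulr_gt0// exprn_gt0//; case/andP: p01 => *; rewrite mulr_gt0 ?subr_gt0.
have blockE (X : {set k.-tuple bool}) : X \subset X0 :|: X1 ->
  lang_prob p (block_lang [set u | size u = k /\ ~ tuple_words X0 u /\ ~ tuple_words X1 u]
    (tuple_words X)) =
  ((\sum_(t in X) word_prob p t) / \sum_(t in X0 :|: X1) word_prob p t)%:E.
  move=> XX; have := lang_prob_block p01 k_gt0 XX.
  rewrite EFinM => <-; rewrite -muleA -EFinM divff ?mule1//.
  by rewrite gt_eqF.
split.
  rewrite (_ : tuple_words X0 `|` tuple_words X1 = tuple_words (X0 :|: X1)).
    by rewrite blockE// divff// gt_eqF.
  apply/seteqP; split=> w.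
    by case=> -[t tX ->]; exists t => //; rewrite inE tX ?orbT.
  by case=> t; rewrite inE => /orP[] tX ->; [left|right]; exists t.
rewrite blockE ?finset.subsetUr// sumX01 (sumX _ c p N X1c NE) -fNM.
congr _%:E; rewrite mulrCA mulfK//.
by rewrite -sumX01 gt_eqF.
Qed.

Lemma rational_block_simulation (R : realType) (D : set R) (f : R -> R) :
  D `<=` [set x | 0 < x < 1] ->
  rational_restriction D f -> has_block_simulation D f.
Proof.
move=> D01 [P [Q [PQ fPQ]]].
have [P' [a a0 PE]] := rat_poly_scale P.
have [Q' [b b0 QE]] := rat_poly_scale Q.
have evalE (p : {poly rat}) p' (z : int) (x : R) : z != 0 ->
    p = z%:~R^-1 *: map_poly intr p' -> (map_poly intr p').[x] = z%:~R * qeval p x.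
  move=> z0 ->; rewrite /qeval map_polyZ/= hornerZ fmorphV/= ratr_int mulrA.
  rewrite divff ?intr_eq0// mul1r -map_poly_comp; congr (_.[x]).
  by apply: eq_map_poly => y /=; rewrite ratr_int.
(* P/Q = N/(N+M), where N+M is a multiple of Q^2, hence positive *)
pose N := (a * b) *: (P' * Q'); pose M := (a ^+ 2) *: Q' ^+ 2 - N.
pose s (x : R) := (a%:~R * b%:~R * qeval Q x) ^+ 2.
have s0 x : 0 < x < 1 -> 0 < s x.
  by move=> /PQ[Q0 _]; rewrite exprn_even_gt0//= !mulf_neq0 ?intr_eq0.
have NE x : 0 < x < 1 -> (map_poly intr N).[x] = s x * (qeval P x / qeval Q x).
  move=> /PQ[Q0 _]; rewrite /N map_polyZ/= hornerZ !rmorphM/= hornerM.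
  rewrite (evalE _ _ _ x a0 PE) (evalE _ _ _ x b0 QE) /s.
  by field.
have NME x : (map_poly intr (N + M)).[x] = s x.
  rewrite /M addrC subrK map_polyZ/= hornerZ !rmorphXn/= horner_exp.
  by rewrite (evalE _ _ _ x b0 QE) /s; ring.
have [|n1 Nn] := @bernstein_nonneg_pos R N.
  by move=> x x01; rewrite NE// mulr_gt0 ?s0//; have [_ /andP[]] := PQ _ x01.
have [|n2 Mn] := @bernstein_nonneg_pos R M.
  move=> x x01; have -> : M = (N + M) - N by rewrite addrC addKr.
  rewrite rmorphB hornerD hornerN NME NE// -{1}[s x]mulr1 -mulrBr mulr_gt0 ?s0// subr_gt0.
  by have [_ /andP[]] := PQ _ x01.
(* Degree elevation brings [N] and [M] to a common degree. *)
apply: (@bernstein_block_simulation R D f N M (maxn n1 n2)) => //.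
- exact: bernstein_nonneg_le (leq_maxl _ _) Nn.
- exact: bernstein_nonneg_le (leq_maxr _ _) Mn.
- move=> p /[dup] Dp /D01 p01; rewrite NME s0//; split=> //.
  by rewrite NE// fPQ// mulrC.
Qed.

Theorem theorem2p2 (R : realType) (D : set R) (f : R -> R)
  (hD : D `<=` [set x | 0 < x < 1]) (hDne : D !=set0)
  (hf : forall p, D p -> 0 < f p < 1) :
  (has_block_simulation D f <-> automaton_simulable D f) /\
  (automaton_simulable D f <-> rational_restriction D f).
Proof.
split; split.
- exact: block_automaton.
- by move/(automaton_rational hD hDne hf)/(rational_block_simulation hD).
- exact: automaton_rational.
- by move/(rational_block_simulation hD)/block_automaton.
Qed.
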